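(* Let $1\le p\le\infty$ with conjugate exponent $q$. Suppose that $f,g:\mathbb{R}\to\mathbb{R}$ are locally Lipschitz, that there are nonnegative constants $k_1,k_2,c_1,c_2$ with $|g(x)|\le k_1|x|+k_2$ and $|f(x)|\le c_1|x|+c_2$ for all $x\in\mathbb{R}$, that $k_1\beta c_1<1$, and that $g\in C^1(\mathbb{R})$ with $|g'(x)|\le k_3|x|+k_4$ for all $x\in\mathbb{R}$ and some nonnegative constants $k_3,k_4$. Let $\sigma>0$ and $R=(1+\sigma)\frac{(k_1\beta c_2+k_1\beta h+k_2)|\Omega|^{1/p}}{1-k_1\beta c_1}$. Then the global attractor $\mathcal{A}$ of the flow $T(t)$ on $L^p(\Omega)$ is contained in the ball $\{u\in L^\infty(\Omega):\|u\|_\infty\le\rho\}$, where $$\rho=k_1\beta\|J\|_q c_1R+k_1\beta\|J\|_q c_2|\Omega|^{1/p}+k_1\beta h+k_2.$$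
   Context: $\Omega\subset\mathbb{R}^N$ ($N\ge1$) is a bounded smooth domain with Lebesgue measure $|\Omega|$ (with $|\Omega|^{1/p}=1$ if $p=\infty$); $h,\beta\ge 0$ are constants. $J:\mathbb{R}^N\times\mathbb{R}^N\to\mathbb{R}$ is a nonnegative symmetric function of class $C^1$ with $\int_{\mathbb{R}^N}J(x,y)\,dy=\int_{\mathbb{R}^N}J(x,y)\,dx=1$, and $\|J\|_r=\sup_{x\in\Omega}\|J(x,\cdot)\|_{L^r(\Omega)}$. The phase space $X=\{u\in L^p(\mathbb{R}^N): u=0 \text{ on }\mathbb{R}^N\setminus\Omega\}$, with the $L^p$ norm, is identified with $L^p(\Omega)$. For $u\in L^p(\Omega)$, $f\circ u$ is regarded as a function on $\Omega$ and $K(f\circ u)(x)=\int_\Omega J(x,y)f(u(y))\,dy$. The map $F$ is $F(u)(x)=g(\beta K(f\circ u)(x)+\beta h)$, $x\in\Omega$ (and $0$ outside $\Omega$). The flow $T(t)$, $t\ge0$, is $T(t)u_0=u(\cdot,t)$, where $u$ is the global solution of $\partial_t u=-u+F(u)$, $u(\cdot,0)=u_0$. The global attractor is the maximal invariant compact set $\mathcal{A}\subset X$ ($T(t)\mathcal{A}=\mathcal{A}$ for all $t\ge0$) attracting each bounded set of $X$. *)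

(* Defs.v *)
From HB Require Import structures.
From mathcomp Require Import all_boot all_order all_algebra.
From mathcomp Require Import all_classical all_reals all_analysis.
From mathcomp Require Import ess_sup_inf measurable_realfun.

Set Implicit Arguments.
Unset Strict Implicit.
Unset Printing Implicit Defensive.
Import Order.TTheory GRing.Theory Num.Theory.
Import numFieldNormedType.Exports.
Local Open Scope classical_set_scope.
Local Open Scope ring_scope.

Fact borel_rV_display : measure_display.
Proof. exact: default_measure_display. Qed.

Section BorelRn.
Context (R : realType) (n : nat).

Definition borel_rV : set (set 'rV[R]_n) := <<s [set U | open U] >>.

Let borel_rV0 : borel_rV set0. Proof. exact: sigma_algebra0. Qed.
Let borel_rVC A : borel_rV A -> borel_rV (~` A).
Proof. exact: sigma_algebraC. Qed.
Let borel_rV_bigcup (F : (set _)^nat) :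
  (forall i, borel_rV (F i)) -> borel_rV (\bigcup_i (F i)).
Proof. exact: sigma_algebra_bigcup. Qed.

HB.instance Definition _ := @isMeasurable.Build borel_rV_display
  'rV[R]_n borel_rV borel_rV0 borel_rVC borel_rV_bigcup.

Lemma open_measurable_rV (U : set 'rV[R]_n) : open U -> measurable U.
Proof. by move=> oU; exact: sub_sigma_algebra. Qed.

Definition rat_box (ab : 'rV[rat]_n * 'rV[rat]_n) : set 'rV[R]_n :=
  [set x | forall i, ratr (ab.1 ord0 i) < x ord0 i < ratr (ab.2 ord0 i)].

Lemma open_rat_box (U : set 'rV[R]_n) : open U ->
  U = \bigcup_(ab in [set ab | rat_box ab `<=` U]) rat_box ab.
Proof.
move=> oU; apply/seteqP; split=> [x Ux|x [ab /= abU]]; last exact: abU.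
have [e /= e0 eU] : nbhs_ball x U by apply/nbhs_ballP; move: oU => /(_ _ Ux).
have /choice[a aP] : forall i, exists q : rat, x ord0 i - e < ratr q < x ord0 i.
  move=> i; have /rat_in_itvoo[q] : x ord0 i - e < x ord0 i by rewrite gtrBl.
  by rewrite in_itv/=; exists q.
have /choice[b bP] : forall i, exists q : rat, x ord0 i < ratr q < x ord0 i + e.
  move=> i; have /rat_in_itvoo[q] : x ord0 i < x ord0 i + e by rewrite ltrDl.
  by rewrite in_itv/=; exists q.
exists (\row_i a i, \row_i b i) => /=; last first.
  by move=> i /=; rewrite !mxE; have /andP[_ ->] := aP i; have /andP[-> _] := bP i.
move=> y /= yab; apply: eU; split => // i j; rewrite ord1.
have := yab j; rewrite /= !mxE => /andP[ay yb].
have /andP[a1 _] := aP j; have /andP[_ b1] := bP j.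
rewrite /ball/= distrC ltr_norml; apply/andP; split.
  by rewrite ltrBrDr addrC (lt_trans a1).
by rewrite ltrBlDr addrC (lt_trans yb).
Qed.

Lemma measurable_fun_rV d (T : measurableType d) (f : T -> 'rV[R]_n) :
  (forall i, measurable_fun setT (fun t => f t ord0 i)) -> measurable_fun setT f.
Proof.
move=> mf; apply: (@measurability _ _ _ _ setT f [set U | open U]) => //.
move=> _ [U /= oU <-]; rewrite setTI (open_rat_box oU) preimage_bigcup.
rewrite bigcup_mkcond; apply: countable_bigcupT_measurable => // -[a b].
case: ifP => _ //.
rewrite (_ : _ @^-1` _ = \bigcap_(i in [set: 'I_n])
   ((fun t => f t ord0 i) @^-1` `]ratr (a ord0 i), ratr (b ord0 i)[)).
  apply: fin_bigcap_measurable => // i _.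
  by rewrite -[X in measurable X]setTI; exact: mf.
apply/seteqP; split => [t /= abt i _|t /= abt i]; first by rewrite /= in_itv/=.
by have := abt i I; rewrite /= in_itv/=.
Qed.

Lemma measurable_coord_rV i : measurable_fun setT (fun x : 'rV[R]_n => x ord0 i).
Proof.
apply: (measurability (@measurable_realfun.RGenOpens.G R)).
  exact: measurable_realfun.RGenOpens.measurableE.
move=> _ [_ /= [a [b ->]] <-]; rewrite setTI; apply: open_measurable_rV.
move/continuousP: (@coord_continuous R 1 n ord0 i); apply.
exact: interval_open.
Qed.

End BorelRn.

Section LebesgueRn.
Context (R : realType).

Definition cons_rV n (p : measurableTypeR R * 'rV[R]_n) : 'rV[R]_n.+1 :=
  \row_i (if unlift ord0 i is Some j then p.2 ord0 j else p.1).

Definition uncons_rV n (x : 'rV[R]_n.+1) : measurableTypeR R * 'rV[R]_n :=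
  (x ord0 ord0, \row_i x ord0 (lift ord0 i)).

Lemma cons_rVK n : cancel (@cons_rV n) (@uncons_rV n).
Proof.
move=> [a v]; rewrite /uncons_rV /cons_rV mxE unlift_none; congr pair.
by apply/rowP => i; rewrite !mxE liftK.
Qed.

Lemma measurable_cons_rV n : measurable_fun setT (@cons_rV n).
Proof.
apply: measurable_fun_rV => i.
rewrite [X in measurable_fun _ X](_ : _ =
    fun p : measurableTypeR R * 'rV[R]_n => if unlift ord0 i is Some j then p.2 ord0 j else p.1); last first.
  by apply/funext => p; rewrite mxE.
case: unliftP => [j _|_]; last exact: measurable_fst.
apply: (measurableT_comp (f := fun v : 'rV_n => v ord0 j)) measurable_snd.
exact: measurable_coord_rV.
Qed.

Lemma measurable_uncons_rV n : measurable_fun setT (@uncons_rV n).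
Proof.
apply/measurable_fun_pairP; split; first exact: measurable_coord_rV.
apply: measurable_fun_rV => i.
rewrite [X in measurable_fun _ X](_ : _ =
  fun x : 'rV_n.+1 => x ord0 (lift ord0 i)); first exact: measurable_coord_rV.
by apply/funext => x /=; rewrite mxE.
Qed.

Section step.
Variables (n : nat) (m : {sigma_finite_measure set 'rV[R]_n -> \bar R}).
Local Open Scope ereal_scope.

Definition lebesgue_step : set 'rV[R]_n.+1 -> \bar R :=
  pushforward (lebesgue_measure \x m) (@cons_rV n).

Let push : {measure set 'rV[R]_n.+1 -> \bar R} :=
  measure_function_pushforward__canonical__measure_function_Measure
    (lebesgue_measure \x m) (@measurable_cons_rV n).

Let step0 : lebesgue_step set0 = 0. Proof. exact: (measure0 push). Qed.
Let step_ge0 A : 0 <= lebesgue_step A. Proof. exact: (measure_ge0 push). Qed.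
Let step_sigma_additive : semi_sigma_additive lebesgue_step.
Proof. exact: (@measure_semi_sigma_additive _ _ _ push). Qed.

HB.instance Definition _ := isMeasure.Build _ _ _ lebesgue_step
  step0 step_ge0 step_sigma_additive.

Let step_sigma_finite : sigma_finite setT lebesgue_step.
Proof.
have /sigma_finiteP[F [TF ndF Foo]] := sigma_finiteT (@lebesgue_measure R).
have /sigma_finiteP[G [TG ndG Goo]] := sigma_finiteT m.
exists (fun k => @uncons_rV n @^-1` (F k `*` G k)).
  rewrite -preimage_bigcup; apply/esym/seteqP; split=> // x _.
  have [i _ Fi] : (\bigcup_i F i) (uncons_rV x).1 by rewrite -TF.
  have [j _ Gj] : (\bigcup_i G i) (uncons_rV x).2 by rewrite -TG.
  exists (maxn i j) => //; split.
  - by move: Fi; apply/subsetPset/ndF/leq_maxl.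
  - by move: Gj; apply/subsetPset/ndG/leq_maxr.
move=> k; have [mF Fk] := Foo k; have [mG Gk] := Goo k.
have mFG : measurable (F k `*` G k) by exact: measurableX.
split; first by rewrite -[X in measurable X]setTI; exact: measurable_uncons_rV.
rewrite /lebesgue_step /pushforward -comp_preimage.
rewrite (_ : _ \o _ = id) ?preimage_id; last first.
  by apply/funext => p; rewrite /= cons_rVK.
by rewrite product_measure1E// lte_mul_pinfty// ge0_fin_numE.
Qed.

HB.instance Definition _ := Measure_isSigmaFinite.Build _ _ _ lebesgue_step
  step_sigma_finite.
End step.

(* lebesgue_rV_box below identifies this measure on boxes. *)
Fixpoint lebesgue_rV n : {sigma_finite_measure set 'rV[R]_n -> \bar R} :=
  match n with
  | 0%N => \d_(0 : 'rV[R]_0)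
  | n'.+1 => lebesgue_step (lebesgue_rV n')
  end.

Lemma lebesgue_rV_box n (a b : 'rV[R]_n) : (forall i, a ord0 i <= b ord0 i) ->
  lebesgue_rV n [set x | forall i, a ord0 i <= x ord0 i <= b ord0 i] =
  (\prod_i (b ord0 i - a ord0 i))%:E.
Proof.
elim: n a b => [|n IH] a b ab /=.
  by rewrite big_ord0 diracE mem_set// => -[].
rewrite /lebesgue_step /pushforward.
pose a' := (uncons_rV a).2; pose b' := (uncons_rV b).2.
rewrite (_ : _ @^-1` _ = (`[a ord0 ord0, b ord0 ord0] : set (measurableTypeR R))
   `*` [set v : 'rV[R]_n | forall i, a' ord0 i <= v ord0 i <= b' ord0 i]);
  last first.
  apply/seteqP; split => -[r v] /=.
    move=> rv; split; first by have := rv ord0; rewrite mxE unlift_none in_itv.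
    by move=> i; have := rv (lift ord0 i); rewrite !mxE liftK.
  move=> [+ vab] i; rewrite in_itv/= mxE; case: unliftP => [k ->|-> //] _.
  by have := vab k; rewrite !mxE.
have mbox : measurable
    [set v : 'rV[R]_n | forall i, a' ord0 i <= v ord0 i <= b' ord0 i].
  rewrite (_ : mkset _ = \bigcap_(i in [set: 'I_n])
     ((fun v : 'rV[R]_n => v ord0 i) @^-1` `[a' ord0 i, b' ord0 i])).
    apply: fin_bigcap_measurable => // i _.
    rewrite -[X in measurable X]setTI.
    by apply: measurable_coord_rV => //; exact: measurable_itv.
  apply/seteqP; split => [v /= vab i _|v /= vab i]; first by rewrite /= in_itv/=.
  by have := vab i I; rewrite /= in_itv/=.
rewrite product_measure1E//=.
rewrite IH => [|i]; last by rewrite !mxE.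
rewrite lebesgue_measure_itv/= lte_fin.
have -> : (if (a ord0 ord0 < b ord0 ord0)%R
    then (b ord0 ord0)%:E - (a ord0 ord0)%:E else 0)%E
    = (b ord0 ord0 - a ord0 ord0)%R%:E.
  by case: ltgtP (ab ord0) => // -> _; rewrite subrr.
rewrite -EFinM big_ord_recl; congr (_ * _)%:E.
by apply: eq_bigr => i _; rewrite !mxE.
Qed.
End LebesgueRn.
(* The library provides the type of L^p classes without algebraic structure; we
   equip it with its operations and the L^p norm. *)
Section LspaceNormed.
Context d (T : measurableType d) (R : realType).
Variables (mu : {measure set T -> \bar R}) (p : \bar R) (p1 : (1 <= p)%E).
Local Open Scope quotient_scope.
Implicit Types (u v w : LspaceType mu p1) (f g : LfunType mu p1).

Lemma ae_eq_Lnorm (f g : T -> R) : measurable_fun setT f ->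
  measurable_fun setT g -> f = g %[ae mu] ->
  ('N[mu]_p[EFin \o f] = 'N[mu]_p[EFin \o g])%E.
Proof.
move=> mf mg fg; rewrite unlock /Lnorm; case: p p1 => [r _|_|//]; last first.
  case: ifP => // _; apply: eq_ess_sup.
  by apply: filterS fg => x /(_ I) /= ->.
congr (_ `^ _)%E; apply: ge0_ae_eq_integral => //.
- apply/measurable_EFinP; apply: (measurableT_comp (measurable_powR r)).
  exact: measurableT_comp.
- apply/measurable_EFinP; apply: (measurableT_comp (measurable_powR r)).
  exact: measurableT_comp.
- by move=> x _; exact: poweR_ge0.
- by move=> x _; exact: poweR_ge0.
- by apply: filterS fg => x /(_ I) /= -> _.
Qed.

Lemma Lspace_eqP u v : (u : T -> R) = v %[ae mu] <-> u = v.
Proof.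
split=> [uv|->]; last exact: nearW.
have : LebesgueSpace.sort u = LebesgueSpace.sort v.
  rewrite -[LHS]reprK -[RHS]reprK; apply/eqP; rewrite eqmodE; exact/asboolP.
case: u v {uv} => [u [[hu]]] [v [[hv]]] /= uv.
by case: _ / uv hv => hv; rewrite (Prop_irrelevance hu hv).
Qed.

Lemma Lspace_measurable u : measurable_fun setT (u : T -> R).
Proof. exact: (@measurable_funPT _ _ _ _ (repr (LebesgueSpace.sort u))). Qed.

Lemma Lspace_Lfun u : (u : T -> R) \in Lfun mu p.
Proof.
rewrite inE; apply/andP; split; rewrite inE/=; first exact: Lspace_measurable.
exact: Lebesgue_finite.
Qed.

Definition rep u : LfunType mu p1 := Lfun_Sub p1 (Lspace_Lfun u).

Let mfR f : {mfun T >-> measurableTypeR R} :=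
  @mfun_Sub _ _ T (measurableTypeR R) f (mem_set (@measurable_funPT _ _ _ _ f)).

Let clsq f : {mfun_ mu, T >-> measurableTypeR R} :=
  \pi_({mfun_ mu, T >-> measurableTypeR R}) (mfR f).

Let clsq_ae f : (repr (clsq f) : T -> R) = f %[ae mu].
Proof.
have : repr (clsq f) = mfR f %[mod {mfun_ mu, T >-> measurableTypeR R}].
  exact: reprK.
by move=> /eqP; rewrite eqmodE => /asboolP.
Qed.

Let clsq_fin f : finite_norm mu p (clsq f).
Proof.
rewrite /finite_norm.
suff -> : ('N[mu]_p[EFin \o clsq f] = 'N[mu]_p[EFin \o f])%E.
  exact: Lfunction_finite.
apply: ae_eq_Lnorm => //; last exact: clsq_ae.
exact: (@measurable_funPT _ _ _ _ (repr (clsq f))).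
Qed.

Definition cls f : LspaceType mu p1 :=
  LebesgueSpace.Pack (LebesgueSpace.Class
    (@isFinLebesgue.Build _ _ _ _ _ p1 (clsq f) (clsq_fin f))).

Lemma cls_ae f : (cls f : T -> R) = f %[ae mu].
Proof. exact: clsq_ae. Qed.

Lemma repK : cancel rep cls.
Proof. by move=> u; apply/Lspace_eqP; exact: cls_ae. Qed.

Lemma cls_eqP f g : f = g %[ae mu] <-> cls f = cls g.
Proof.
split=> [fg|/Lspace_eqP fg].
  apply/Lspace_eqP; move: (cls_ae f) (cls_ae g) fg.
  by apply: filterS3 => x /(_ I) fx /(_ I) gx /(_ I) fg _; rewrite fx fg gx.
move: (cls_ae f) (cls_ae g) fg.
by apply: filterS3 => x /(_ I) fx /(_ I) gx /(_ I) fg _; rewrite -fx fg gx.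
Qed.


Definition Lspace_zero : LspaceType mu p1 := cls 0.
Definition Lspace_opp u := cls (- rep u).
Definition Lspace_add u v := cls (rep u + rep v).
Definition Lspace_scale (a : R) u := cls (a *: rep u).

Lemma Lspace_addE f g : Lspace_add (cls f) (cls g) = cls (f + g).
Proof.
apply/cls_eqP; move: (cls_ae f) (cls_ae g); apply: filterS2.
by move=> x /(_ I) fx /(_ I) gx _; exact: (congr2 +%R fx gx).
Qed.

Lemma Lspace_scaleE a f : Lspace_scale a (cls f) = cls (a *: f).
Proof.
apply/cls_eqP; move: (cls_ae f); apply: filterS.
by move=> x /(_ I) fx _; exact: (congr1 ( *%R a) fx).
Qed.

Lemma Lspace_oppE f : Lspace_opp (cls f) = cls (- f).
Proof.
apply/cls_eqP; move: (cls_ae f); apply: filterS.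
by move=> x /(_ I) fx _; exact: (congr1 -%R fx).
Qed.

HB.instance Definition _ := gen_eqMixin (LspaceType mu p1).
HB.instance Definition _ := gen_choiceMixin (LspaceType mu p1).

Let addA : associative Lspace_add.
Proof.
move=> u v w; rewrite -(repK u) -(repK v) -(repK w) !Lspace_addE.
by rewrite addrA.
Qed.

Let addC : commutative Lspace_add.
Proof. by move=> u v; rewrite -(repK u) -(repK v) !Lspace_addE addrC. Qed.

Let add0 : left_id Lspace_zero Lspace_add.
Proof. by move=> u; rewrite -(repK u) Lspace_addE add0r. Qed.

Let addN : left_inverse Lspace_zero Lspace_opp Lspace_add.
Proof. by move=> u; rewrite -(repK u) Lspace_oppE Lspace_addE addNr. Qed.

HB.instance Definition _ :=
  GRing.isZmodule.Build (LspaceType mu p1) addA addC add0 addN.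

Lemma clsD f g : cls (f + g) = cls f + cls g.
Proof. by rewrite -Lspace_addE. Qed.

Let scaleA a b u : Lspace_scale a (Lspace_scale b u) = Lspace_scale (a * b) u.
Proof. by rewrite -(repK u) !Lspace_scaleE scalerA. Qed.

Let scale1 : left_id 1 Lspace_scale.
Proof. by move=> u; rewrite -(repK u) Lspace_scaleE scale1r. Qed.

Let scaleDr : right_distributive Lspace_scale +%R.
Proof.
move=> a u v; rewrite -(repK u) -(repK v) -clsD !Lspace_scaleE -clsD.
by rewrite scalerDr.
Qed.

Let scaleDl u : {morph Lspace_scale^~ u : a b / a + b}.
Proof.
by move=> a b; rewrite -(repK u) !Lspace_scaleE -clsD scalerDl.
Qed.

HB.instance Definition _ := GRing.Zmodule_isLmodule.Build R (LspaceType mu p1)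
  scaleA scale1 scaleDr scaleDl.

Lemma clsZ a f : cls (a *: f) = a *: cls f.
Proof. by rewrite -Lspace_scaleE. Qed.

Definition Lspace_norm u : R := fine 'N[mu]_p[EFin \o u]%E.

Lemma Lspace_norm_cls f : Lspace_norm (cls f) = fine 'N[mu]_p[EFin \o f]%E.
Proof.
congr fine; apply: ae_eq_Lnorm; [exact: Lspace_measurable|by []|exact: cls_ae].
Qed.

Let normD u v : Lspace_norm (u + v) <= Lspace_norm u + Lspace_norm v.
Proof.
by rewrite -(repK u) -(repK v) -clsD !Lspace_norm_cls; exact: ler_LnormD.
Qed.

Let normZ a u : Lspace_norm (a *: u) = `|a| * Lspace_norm u.
Proof.
rewrite -(repK u) -clsZ !Lspace_norm_cls.
have := LnormZ (rep u) a; rewrite -[X in (_ * X)%E]finite_norm_fine -EFinM.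
by move=> /(congr1 fine).
Qed.

Let norm0_eq0 u : Lspace_norm u = 0 -> u = 0.
Proof.
rewrite -[in X in X -> _](repK u) Lspace_norm_cls => /fine_Lnormr_eq0 u0.
by rewrite -(repK u); apply/cls_eqP.
Qed.

HB.instance Definition _ := Lmodule_isNormed.Build R (LspaceType mu p1)
  normD normZ norm0_eq0.

Lemma Lspace_normE u : (`|u|%:E = 'N[mu]_p[EFin \o u])%E.
Proof. exact: (finite_norm_fine (rep u)). Qed.

Lemma LspaceD_ae u v :
  ((u + v : LspaceType mu p1) : T -> R) = (fun x => u x + v x) %[ae mu].
Proof. exact: cls_ae. Qed.

Lemma LspaceZ_ae a u :
  ((a *: u : LspaceType mu p1) : T -> R) = (fun x => a * u x) %[ae mu].
Proof. exact: cls_ae. Qed.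

End LspaceNormed.

Section Regularity.
Context (R : realType).

(* Class C^k through directional derivatives; on the finite-dimensional spaces
   where it is used this is the usual notion. *)
Fixpoint Ck (V : normedModType R) (k : nat) (f : V -> R) : Prop :=
  continuous f /\
  if k is k'.+1 then
    forall v, (forall x, derivable f x v) /\ Ck k' (fun x => 'D_v f x)
  else True.

Definition smooth (V : normedModType R) (f : V -> R) := forall k, Ck k f.

Definition locally_lipschitz (f : R -> R) :=
  forall x : R, exists2 U : set R, nbhs x U & [lipschitz f y | y in U].

(* Near each boundary point, Omega is the sublevel set {phi < 0} of a smooth
   function phi whose differential does not vanish at that point. *)
Definition smooth_boundary N (Omega : set 'rV[R]_N) :=
  forall x, (closure Omega `\` Omega°) x ->
  exists phi : 'rV[R]_N -> R,
    [/\ smooth phi,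
        exists v, 'D_v phi x != 0 &
        \forall y \near x, Omega y <-> phi y < 0].

Definition bounded_smooth_domain N (Omega : set 'rV[R]_N) :=
  [/\ Omega !=set0, open Omega, connected Omega, bounded_set Omega &
      smooth_boundary Omega].

End Regularity.

Section Dynamics.
Context (R : realType) (V : normedModType R).
Variables (X : set V) (T : R -> V -> V).

Definition invariant_set (A : set V) := forall t : R, 0 <= t -> T t @` A = A.

Definition attracts (A B : set V) := forall e : R, 0 < e ->
  \forall t \near +oo, forall u, B u -> exists2 a, A a & `|T t u - a| < e.

Definition global_attractor (A : set V) :=
  [/\ A `<=` X, compact A, invariant_set A,
      (forall B, B `<=` X -> bounded_set B -> attracts A B) &
      (forall A', A' `<=` X -> compact A' -> invariant_set A' -> A' `<=` A)].

End Dynamics.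

Section Model.
Context (R : realType) (N : nat) (p : \bar R) (p1 : (1 <= p)%E).
Variables (Omega : set 'rV[R]_N) (J : 'rV[R]_N -> 'rV[R]_N -> R).
Variables (f g : R -> R) (h beta : R).
Local Notation mu := (lebesgue_rV R N).
Local Notation Lp := (LspaceType mu p1).

Definition interaction_kernel :=
  [/\ forall x y, 0 <= J x y,
      forall x y, J x y = J y x,
      Ck 1 (fun z : 'rV[R]_N * 'rV[R]_N => J z.1 z.2),
      forall x, (\int[mu]_y (J x y)%:E)%E = 1%E &
      forall y, (\int[mu]_x (J x y)%:E)%E = 1%E].

Definition kernel_norm (r : \bar R) : \bar R :=
  ereal_sup [set 'N[mu]_r[EFin \o (J x \_ Omega)]%E | x in Omega].

(* |Omega|^(1/p), equal to 1 for p = +oo. *)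
Definition volume_root : R :=
  if p is r%:E then fine (mu Omega) `^ r^-1 else 1.

Definition phase_space : set Lp :=
  [set u | (u : 'rV[R]_N -> R) = cst 0 %[ae mu in ~` Omega]].

Definition Linfty_ball (rho : \bar R) : set Lp :=
  [set u | [/\ phase_space u, (u : 'rV[R]_N -> R) \in Lfun mu +oo%E &
               ('N[mu]_+oo[EFin \o u] <= rho)%E]].

(* The class in L^p of a function, with the junk value 0 outside L^p. *)
Definition Lp_class (v : 'rV[R]_N -> R) : Lp :=
  if pselect (v \in Lfun mu p) is left vp then cls (Lfun_Sub p1 vp) else 0.

Definition Kop (v : 'rV[R]_N -> R) (x : 'rV[R]_N) : R :=
  \int[mu]_(y in Omega) (J x y * v y).

(* Under linear growth of f and g the argument of Lp_class is in L^p. *)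
Definition Fmap (u : Lp) : Lp :=
  Lp_class ((fun x => g (beta * Kop (f \o u) x + beta * h)) \_ Omega).

Definition global_solution (u0 : Lp) (u : R -> Lp) :=
  [/\ u 0 = u0,
      forall t : R, 0 <= t -> phase_space (u t),
      {within `[0, +oo[, continuous u} &
      forall t : R, 0 < t -> is_derive t 1 u (- u t + Fmap (u t))].

Definition flow (T : R -> Lp -> Lp) :=
  forall u0, phase_space u0 -> global_solution u0 (fun t => T t u0).

End Model.

(* Main.v *)
Require Import Defs.
From mathcomp Require Import all_boot all_order all_algebra.
From mathcomp Require Import all_classical all_reals all_analysis.
From mathcomp Require Import ess_sup_inf measurable_realfun.
From mathcomp Require Import ring lra.

Set Implicit Arguments.
Unset Strict Implicit.
Unset Printing Implicit Defensive.
Import Order.TTheory GRing.Theory Num.Theory.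
Import numFieldNormedType.Exports.
Local Open Scope classical_set_scope.
Local Open Scope ring_scope.

(** The proof never integrates the equation: it looks at a point of the
    attractor [A] where a convex functional is largest.  Let [Phi] be a convex
    functional on [L^p] with [Phi (u + r) <= Phi u + |r|].  As [A] is compact,
    [Phi] attains its maximum on [A] at some [m], and invariance gives
    [m = T 1 w] with the whole trajectory of [w] inside [A].  Differentiating
    at [t = 1],

      [(1 + s) m = T (1 - s) w + s F m + o(s)]   as [s] decreases to [0],

    so convexity yields [(1 + s) Phi m <= Phi m + s Phi (F m) + o(s)], that is
    [Phi m <= Phi (F m)] ([invariant_set_bound]).

    This is applied twice.  With [Phi] the [L^p] norm, the linear growth of [f]
    and [g] and Schur's test for the kernel [J], both of whose marginals have
    mass one, give [|F u| <= a |u| + b] with [a = k1 beta c1 < 1]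
    ([Fmap_Lnorm_le]); hence [|u| <= b / (1 - a) <= Rad] on [A].  With [Phi u]
    the [L^p] norm of the part of [|u|] above the level [rho] ([excess]),
    Hoelder's inequality in [y] shows that [|F u| <= rho] almost everywhere as
    soon as [|u| <= Rad] ([Fmap_Linfty_le]), so that [Phi (F m) = 0]; hence
    [Phi] vanishes on [A], which says that [|u| <= rho] almost everywhere.

    The extended real [rho] is finite because [J] is bounded on the bounded set
    [Omega * Omega] ([kernel_norm_lty]). *)

(** * Convex functionals on compact invariant sets *)

Section FarthestPoint.
Context (R : realType) (V : normedModType R).
Variables (A : set V) (T : R -> V -> V) (F : V -> V) (Phi : V -> R).
Hypothesis Phi_convex : forall (l : R) u v, 0 <= l <= 1 ->
  Phi (l *: u + (1 - l) *: v) <= l * Phi u + (1 - l) * Phi v.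
Hypothesis Phi_add : forall u r, Phi (u + r) <= Phi u + `|r|.

Let Phi_continuous : continuous Phi.
Proof.
move=> u; apply/cvgrPdist_le => e e0; near=> v.
have uv : `|u - v| <= e by near: v; exact: cvgr_dist_le.
apply: le_trans uv; rewrite ler_norml; apply/andP; split.
  rewrite lerNl opprB lerBlDl distrC -{1}(subrK u v) (addrC (v - u)).
  exact: Phi_add.
by rewrite lerBlDl -{1}(subrK v u) (addrC (u - v)) Phi_add.
Unshelve. all: by end_near. Qed.

Let backward_step (u : R -> V) :
  is_derive (1 : R) (1 : R) u (- u 1 + F (u 1)) ->
  forall e, 0 < e -> exists2 h : R, 0 < h < 1 &
    `|u (1 - h) + h *: F (u 1) - (1 + h) *: u 1| <= h * e.
Proof.
move=> [du Du] e e0.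
have : (fun h : R => h^-1 *: (u (h *: 1 + 1) - u 1)) @ 0^'
    --> - u 1 + F (u 1) by rewrite -Du; exact: du.
move=> /cvgrPdist_le /(_ _ e0) [/= d d0 dP].
pose h := Num.min (d / 2) 2^-1.
have h0 : 0 < h by rewrite lt_min; apply/andP; split; lra.
have hd : h < d by rewrite /h; have := ge_min (d / 2) (d / 2) 2^-1; lra.
exists h; first by rewrite h0 /h gt_min; apply/orP; right; lra.
(* The difference quotient is taken on the left, where the trajectory has
   already been. *)
have := dP (- h); rewrite /= sub0r opprK gtr0_norm// oppr_eq0 gt_eqF//.
move=> /(_ hd isT).
have -> : ((- h)%:A + 1 : R) = 1 - h by rewrite [_%:A]mulr1 addrC.
rewrite -(ler_pM2l h0) -{1}(gtr0_norm h0) -normrZ.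
suff -> : h *: (- u 1 + F (u 1) - (- h)^-1 *: (u (1 - h) - u 1)) =
    u (1 - h) + h *: F (u 1) - (1 + h) *: u 1 by [].
rewrite scalerBr scalerA invrN mulrN mulfV ?gt_eqF// scaleN1r opprK.
rewrite scalerDr scalerN scalerDl scale1r opprD addrC (addrC (- _)) addrA.
by rewrite (addrAC _ (- u 1)) -!addrA.
Qed.

(** At a point [m] of [A] where [Phi] is largest, the trajectory arrives from a
    point of [A] where [Phi] is no larger, and to first order it moves along
    the segment towards [F m]; convexity then forces [Phi m <= Phi (F m)], and
    the affine bound on [Phi (F m)] closes on itself because [a < 1]. *)
Lemma invariant_set_bound (a b : R) : compact A -> invariant_set T A ->
  (forall w, A w -> is_derive (1 : R) (1 : R) (fun t => T t w)
                              (- T 1 w + F (T 1 w))) ->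
  a < 1 -> (forall u, A u -> Phi (F u) <= a * Phi u + b) ->
  forall u, A u -> Phi u <= b / (1 - a).
Proof.
move=> cA iA dT a1 FA u Au.
have [m mA mmax] : exists2 m, m \in A & forall v, v \in A -> Phi v <= Phi m.
  apply: compact_EVT_max => //; first by exists u.
  exact: continuous_subspaceT.
have Am : A m by rewrite inE in mA.
apply: (le_trans (mmax _ (mem_set Au))).
have [w Aw wm] : exists2 w, A w & T 1 w = m.
  by have := iA _ ler01; rewrite predeqE => /(_ m)[_ /(_ Am)].
rewrite ler_pdivlMr ?subr_gt0// mulrBr mulr1 lerBlDr (mulrC _ a) addrC.
apply: (le_trans _ (FA _ Am)); apply/ler_addgt0Pr => e e0.
have [h /andP[h0 h1]] := backward_step (dT _ Aw) e0; rewrite wm.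
set v := T (1 - h) w; set r := (X in `|X| <= _) => rP.
have Av : A v.
  by rewrite -(iA (1 - h)) ?subr_ge0 ?ltW//; exists w.
have h10 : 0 < 1 + h by lra.
(* [m] is, up to [r], the convex combination of [v] and [F m] with weight
   [l] on [v]. *)
pose l := (1 + h)^-1.
have l0 : 0 < l by rewrite invr_gt0.
have l1 : l * (1 + h) = 1 by rewrite mulVf// gt_eqF.
have lh : l * h = 1 - l by rewrite -l1; ring.
have mE : m = (l *: v + (1 - l) *: F m) + (- l) *: r.
  rewrite /r -lh scaleNr !scalerBr !scalerDr !scalerA l1 scale1r.
  by rewrite opprB addrC subrK.
have : Phi m <= l * Phi v + (1 - l) * Phi (F m) + l * `|r|.
  rewrite {1}mE (le_trans (Phi_add _ _))// normrZ normrN (gtr0_norm l0).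
  by rewrite lerD2r Phi_convex// ltW//= -subr_ge0 -lh mulr_ge0// ltW.
have := mmax _ (mem_set Av) => vm H.
have {}H : Phi m <= l * Phi m + (1 - l) * Phi (F m) + l * (h * e).
  by apply: le_trans H _; rewrite !lerD// ler_pM2l.
have l10 : 0 < 1 - l by rewrite -lh mulr_gt0.
by rewrite mulrA lh in H; rewrite -(ler_pM2l l10); lra.
Qed.

End FarthestPoint.

(** * Inequalities for the norms of L^p *)

Section Lnorm_inequalities.
Context d (T : measurableType d) (R : realType).
Variable mu : {measure set T -> \bar R}.
Local Open Scope ereal_scope.
Implicit Types (p : \bar R).

Lemma Lnormy_ge (f : T -> \bar R) : \forall x \ae mu, `|f x| <= 'N[mu]_+oo[f].
Proof.
rewrite unlock; case: ifPn => [_|]; first exact: ess_sup_ge.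
rewrite -leNgt => mu0; exists setT; split => //.
by apply/eqP; rewrite eq_le mu0/=.
Qed.

Lemma Lnormy_le (f : T -> \bar R) (M : \bar R) : 0 <= M ->
  (\forall x \ae mu, `|f x| <= M) -> 'N[mu]_+oo[f] <= M.
Proof.
by move=> M0 fM; rewrite unlock; case: ifPn => // _; exact/ess_supP.
Qed.

Lemma le_Lnorm p (f g : T -> \bar R) : 1 <= p ->
  measurable_fun setT f -> measurable_fun setT g ->
  (\forall x \ae mu, `|f x| <= `|g x|) -> 'N[mu]_p[f] <= 'N[mu]_p[g].
Proof.
case: p => [r r1|_|//] mf mg fg; last first.
  apply: Lnormy_le; first exact: Lnorm_ge0.
  by apply: filterS2 fg (Lnormy_ge g) => x; exact: le_trans.
have r0 : (0 < r)%R by rewrite (lt_le_trans ltr01).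
have mr (k : T -> \bar R) : measurable_fun setT k ->
    measurable_fun setT (fun x => `|k x| `^ r).
  move=> mk; apply: (measurableT_comp (measurable_poweR r)).
  exact: measurableT_comp.
have mono s : (0 <= s)%R -> forall x y : \bar R, 0 <= x -> x <= y ->
    x `^ s <= y `^ s.
  move=> s0 x y x0 xy; apply: gt0_ler_poweR => //; rewrite in_itv/= leey ?x0//.
  by rewrite (le_trans x0).
rewrite unlock; apply: (mono); first by rewrite invr_ge0 ltW.
  by apply: integral_ge0 => x _; exact: poweR_ge0.
apply: ae_ge0_le_integral => //; [|exact: mr| |exact: mr|].
- by move=> x _; exact: poweR_ge0.
- by move=> x _; exact: poweR_ge0.
- by apply: filterS fg => x fg _; apply: mono => //; exact: ltW.
Qed.

Let integral_ae_mul (f g : T -> R) : measurable_fun setT f ->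
  measurable_fun setT g ->
  \int[mu]_x `|(f x * g x)%:E| <= 'N[mu]_1[EFin \o f] * 'N[mu]_+oo[EFin \o g].
Proof.
move=> mf mg; have Mg := Lnormy_ge (EFin \o g).
set M := 'N[mu]_+oo[_] in Mg *.
have M0 : 0 <= M by exact: Lnorm_ge0.
rewrite Lnorm1 muleC -ge0_integralZl//; last first.
  by apply/measurableT_comp => //; exact/measurable_EFinP.
apply: ae_ge0_le_integral => //.
- by apply/measurableT_comp => //; apply/measurable_EFinP/measurable_funM.
- by move=> x _; rewrite mule_ge0.
- apply: emeasurable_funM => //.
  by apply/measurableT_comp => //; exact/measurable_EFinP.
- by apply: filterS Mg => x gM _; rewrite EFinM abseM muleC lee_wpmul2r.
Qed.

Lemma hoelder_conjugate_le p (f g : T -> R) : 1 <= p ->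
  measurable_fun setT f -> measurable_fun setT g ->
  \int[mu]_x `|(f x * g x)%:E| <=
  'N[mu]_p[EFin \o f] * 'N[mu]_(hoelder_conjugate p)[EFin \o g].
Proof.
case: p => [r|_|//]; last first.
  rewrite hoelder_conjugatey => mf mg; rewrite muleC.
  by under eq_integral do rewrite mulrC; exact: integral_ae_mul.
rewrite le_eqVlt => /predU1P[<-|r1].
  by rewrite hoelder_conjugate1 => mf mg; exact: integral_ae_mul.
have r0 : (0 < r)%R by rewrite (lt_trans ltr01).
rewrite /hoelder_conjugate/= eqe gt_eqF//.
rewrite -EFinD inver subr_eq0 gt_eqF// -EFinM => mf mg.
have q0 : (0 < r / (r - 1))%R by rewrite divr_gt0// subr_gt0.
have rq : (r^-1 + (r / (r - 1))^-1 = 1)%R.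
  by rewrite invf_div -[X in (X + _)%R]div1r -mulrDl subrKC divff// gt_eqF.
by have := hoelder mu mf mg r0 q0 rq; rewrite Lnorm1.
Qed.

(** Jensen's inequality for [t ^ r] and the density [k], obtained from Hoelder's
    inequality for the factors [k ^ (1/r) * w] and [k ^ (1 - 1/r)]. *)
Lemma integral_density_poweR (k w : T -> R) (r : R) : (1 <= r)%R ->
  measurable_fun setT k -> measurable_fun setT w ->
  (forall x, 0 <= k x)%R -> (forall x, 0 <= w x)%R ->
  \int[mu]_x (k x)%:E <= 1 ->
  (\int[mu]_x (k x * w x)%:E) `^ r <= \int[mu]_x (k x * w x `^ r)%:E.
Proof.
rewrite le_eqVlt => /predU1P[<- mk mw k0 w0 _|r1 mk mw k0 w0 k1].
  rewrite poweRe1; last by apply: integral_ge0 => x _; rewrite lee_fin mulr_ge0.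
  by under [leRHS]eq_integral do rewrite powRr1//.
have r0 : (0 < r)%R by rewrite (lt_trans ltr01).
pose q := (r / (r - 1))%R.
have q0 : (0 < q)%R by rewrite divr_gt0// subr_gt0.
have rq : (r^-1 + q^-1 = 1)%R.
  by rewrite invf_div -[X in (X + _)%R]div1r -mulrDl subrKC divff// gt_eqF.
have mkX s : measurable_fun setT (fun x => k x `^ s)%R.
  exact: (measurableT_comp (measurable_powR s)).
pose F x := (k x `^ r^-1 * w x)%R.
pose G x := (k x `^ q^-1)%R.
have := @hoelder _ _ _ mu F G r q (measurable_funM (mkX _) mw) (mkX _) r0 q0 rq.
have F0 x : (0 <= F x)%R by rewrite mulr_ge0// powR_ge0.
have -> : 'N[mu]_1[EFin \o (F \* G)%R] = \int[mu]_x (k x * w x)%:E.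
  rewrite Lnorm1; apply: eq_integral => x _ /=.
  rewrite ger0_norm ?mulr_ge0 ?powR_ge0// /F /G mulrAC.
  by rewrite -powRD ?rq ?powRr1// oner_eq0.
move=> FG.
have Gle1 : 'N[mu]_q%:E[EFin \o G] <= 1.
  rewrite unlock -[leRHS](poweR1r q^-1); apply: gt0_ler_poweR.
  - by rewrite invr_ge0 ltW.
  - by rewrite in_itv/= leey integral_ge0// => x _; exact: poweR_ge0.
  - by rewrite in_itv/= leey lee01.
  apply: le_trans k1; under eq_integral => x _.
    rewrite /= ger0_norm ?powR_ge0// -powRrM mulVf ?gt_eqF// powRr1//. over.
  by [].
have {}FG : \int[mu]_x (k x * w x)%:E <= 'N[mu]_r%:E[EFin \o F].
  by apply: le_trans FG _; rewrite -[leRHS]mule1 lee_wpmul2l// Lnorm_ge0.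
have -> : \int[mu]_x (k x * w x `^ r)%:E = 'N[mu]_r%:E[EFin \o F] `^ r.
  rewrite powR_Lnorm ?gt_eqF//; apply: eq_integral => x _ /=.
  rewrite ger0_norm// /F powRM ?powR_ge0// -powRrM mulVf ?gt_eqF//.
  by rewrite powRr1.
apply: gt0_ler_poweR => //; first exact: ltW.
- by rewrite in_itv/= leey integral_ge0// => x _; rewrite lee_fin mulr_ge0.
- by rewrite in_itv/= leey Lnorm_ge0.
Qed.

End Lnorm_inequalities.

(** * Schur's test *)

Section SchurTest.
Context d (T : measurableType d) (R : realType).
Variable mu : {sigma_finite_measure set T -> \bar R}.
Variable J : T -> T -> R.
Hypothesis mJ : measurable_fun setT (fun z : T * T => J z.1 z.2).
Hypothesis J0 : forall x y, 0 <= J x y.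
Local Open Scope ereal_scope.
Hypothesis J1r : forall x, \int[mu]_y (J x y)%:E <= 1.
Hypothesis J1l : forall y, \int[mu]_x (J x y)%:E <= 1.

Let mJw (w : T -> R) : measurable_fun setT w ->
  measurable_fun setT (fun z : T * T => (J z.1 z.2 * w z.2)%:E).
Proof.
move=> mw; apply/measurable_EFinP/measurable_funM => //.
exact: (measurableT_comp mw measurable_snd).
Qed.

Lemma kernel_section_measurable x : measurable_fun setT (J x).
Proof. exact: (measurableT_comp mJ (pair1_measurable x)). Qed.

Lemma kernel_average_measurable (w : T -> R) : measurable_fun setT w ->
  (forall x, 0 <= w x)%R ->
  measurable_fun setT (fun x => \int[mu]_y (J x y * w y)%:E).
Proof.
move=> mw w0.
apply: (measurable_fun_fubini_tonelli_F _ (mJw mw)) => z.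
by rewrite lee_fin mulr_ge0.
Qed.

(** Schur's test: averaging against a kernel whose marginals have mass at most
    one contracts every [L^p] norm.  For finite [p], Jensen's inequality in [y]
    uses the first marginal, and exchanging the integrals leaves the second. *)
Lemma schur_test p (w : T -> R) : 1 <= p -> measurable_fun setT w ->
  (forall x, 0 <= w x)%R ->
  'N[mu]_p[(fun x => \int[mu]_y (J x y * w y)%:E)] <= 'N[mu]_p[EFin \o w].
Proof.
have Jw0 v x y : (forall y, 0 <= v y)%R -> 0 <= (J x y * v y)%:E.
  by move=> v0; rewrite lee_fin mulr_ge0.
case: p => [r r1|_|//] mw w0; last first.
  have [->|] := eqVneq 'N[mu]_+oo[EFin \o w] +oo; first by rewrite leey.
  rewrite -ltey => Moo.
  have M0 : 0 <= 'N[mu]_+oo[EFin \o w] by exact: Lnorm_ge0.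
  have wM := Lnormy_ge mu (EFin \o w).
  set M := 'N[mu]_+oo[_] in Moo M0 wM *.
  apply: Lnormy_le => //; apply: nearW => x.
  rewrite gee0_abs; last by apply: integral_ge0 => y _; exact: Jw0.
  apply: (@le_trans _ _ (\int[mu]_y (M * (J x y)%:E))).
    have mJx : measurable_fun setT (J x) := kernel_section_measurable x.
    apply: ae_ge0_le_integral => //.
    - by move=> y _; exact: Jw0.
    - exact/measurable_EFinP/measurable_funM.
    - by move=> y _; rewrite mule_ge0// lee_fin.
    - by apply: emeasurable_funM => //; exact/measurable_EFinP.
    - apply: filterS wM => y /= wM _.
      rewrite EFinM muleC lee_wpmul2r ?lee_fin//.
      by move: wM; rewrite ger0_norm.
  rewrite ge0_integralZl//.
  - by rewrite -[leRHS]mule1 lee_wpmul2l.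
  - exact/measurable_EFinP/kernel_section_measurable.
  - by move=> y _; rewrite lee_fin.
have r0 : (0 < r)%R by rewrite (lt_le_trans ltr01).
have mwr : measurable_fun setT (fun x => w x `^ r)%R.
  exact: (measurableT_comp (measurable_powR r)).
have wr0 x : (0 <= w x `^ r)%R by exact: powR_ge0.
rewrite unlock; apply: gt0_ler_poweR.
- by rewrite invr_ge0 ltW.
- by rewrite in_itv/= leey integral_ge0// => x _; exact: poweR_ge0.
- by rewrite in_itv/= leey integral_ge0// => x _; exact: poweR_ge0.
apply: (@le_trans _ _ (\int[mu]_x \int[mu]_y (J x y * w y `^ r)%:E)).
  apply: ge0_le_integral => //.
  - by move=> x _; exact: poweR_ge0.
  - apply: (measurableT_comp (measurable_poweR r)).
    by apply: measurableT_comp => //; exact: kernel_average_measurable.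
  - exact: kernel_average_measurable.
  - move=> x _; rewrite gee0_abs; last first.
      by apply: integral_ge0 => y _; exact: Jw0.
    apply: integral_density_poweR => //; exact: kernel_section_measurable.
rewrite (fubini_tonelli (fun z => (J z.1 z.2 * w z.2 `^ r)%:E)) /=;
  last 2 first.
- exact: (mJw mwr).
- by move=> z; exact: (Jw0 _ z.1 z.2 wr0).
apply: ge0_le_integral => //.
- by move=> y _; apply: integral_ge0 => x _; exact: (Jw0 _ x y wr0).
- apply: (measurable_fun_fubini_tonelli_G _ (mJw mwr)) => z.
  exact: (Jw0 _ z.1 z.2 wr0).
- apply/measurable_EFinP/(measurableT_comp (measurable_powR r)).
  exact: measurableT_comp.
- move=> y _; have mJy : measurable_fun setT (J ^~ y).
    exact: (measurableT_comp mJ (pair2_measurable y)).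
  under eq_integral do rewrite EFinM muleC.
  rewrite ge0_integralZl//; last by rewrite lee_fin.
  + by rewrite /= ger0_norm// -[leRHS]mule1 lee_wpmul2l// lee_fin.
  + exact/measurable_EFinP.
  + by move=> x _; rewrite lee_fin.
Qed.

End SchurTest.

(** * Borel functions and bounded sets in Euclidean space *)

Section EuclideanSpace.
Context (R : realType).

Lemma continuous_measurable_rV n (f : 'rV[R]_n -> R) :
  continuous f -> measurable_fun setT f.
Proof.
move=> cf; apply: (measurability (@RGenOpens.G R)).
  exact: RGenOpens.measurableE.
move=> _ [_ /= [a [b ->]] <-]; rewrite setTI; apply: open_measurable_rV.
by move/continuousP: cf; apply; exact: interval_open.
Qed.

Lemma row_split_continuous m n :
  continuous (fun z : 'rV[R]_(m + n) => (lsubmx z, rsubmx z)).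
Proof.
move=> z A /nbhs_ballP[e /= e0 zA]; apply/nbhs_ballP; exists e => //= y zy.
by apply: zA; split; split => // i j; rewrite !mxE; apply: zy.2.
Qed.

(** Joint continuity gives measurability for the product of the two Borel
    sigma-algebras: a pair of vectors is glued into one vector, coordinate by
    coordinate, and continuous functions of that vector are Borel. *)
Lemma continuous_measurable_rV2 m n (f : 'rV[R]_m * 'rV[R]_n -> R) :
  continuous f -> measurable_fun setT f.
Proof.
move=> cf.
pose r (z : 'rV[R]_m * 'rV[R]_n) : 'rV[R]_(m + n) := row_mx z.1 z.2.
have -> : f = (fun z => f (lsubmx z, rsubmx z)) \o r.
  by apply/funext => -[x y] /=; rewrite /r /= row_mxKl row_mxKr.
apply: measurableT_comp; last first.
  apply: measurable_fun_rV => i; rewrite /r.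
  case: (split_ordP i) => j ->.
    under eq_fun do rewrite row_mxEl.
    exact: (measurableT_comp (measurable_coord_rV j) measurable_fst).
  under eq_fun do rewrite row_mxEr.
  exact: (measurableT_comp (measurable_coord_rV j) measurable_snd).
apply: continuous_measurable_rV => z.
exact: (continuous_comp (@row_split_continuous _ _ z) (cf _)).
Qed.

(** The cube of half-side a bound of [D] serves both to bound the measure of
    [D] and to bound continuous functions on it. *)
Lemma bounded_sub_compact n (D : set 'rV[R]_n) : bounded_set D ->
  exists Q : set 'rV[R]_n,
    [/\ D `<=` Q, compact Q, measurable Q & (lebesgue_rV R n Q < +oo)%E].
Proof.
move=> [M [_ /(_ _ (ltr_pwDr ltr01 (lexx M)))]]; set K := M + 1 => DM.
pose Q : set 'rV[R]_n := [set v | forall i, `[- `|K|, `|K|]%classic (v ord0 i)].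
have cQ : compact Q.
  apply: (@rV_compact _ _ (fun=> `[- `|K|, `|K|]%classic)) => _.
  exact: segment_compact.
exists Q; split => //.
- move=> v /DM vM i; rewrite /= in_itv/= -ler_norml.
  apply: le_trans (ler_norm K); apply: le_trans _ vM.
  (* The norm of a row is the largest absolute value of its entries. *)
  have /mapP[j Hj ->] : `|v ord0 i| \in [seq `|v x.1 x.2| | x : 'I_1 * 'I_n].
    by apply/mapP; exists (ord0, i) => //=; rewrite mem_enum.
  rewrite [leRHS]/Num.Def.normr /= mx_normrE.
  by apply/bigmax_geP; right; exists j.
- rewrite -[Q]setCK; apply: measurableC; apply: open_measurable_rV.
  by apply: closed_openC; exact: compact_closed.
- pose a : 'rV[R]_n := const_mx (- `|K|); pose b : 'rV[R]_n := const_mx `|K|.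
  have -> : Q = [set x : 'rV[R]_n | forall i, a ord0 i <= x ord0 i <= b ord0 i].
    apply/seteqP; split => v /= vM i; have := vM i.
      by rewrite /= in_itv/= !mxE.
    by rewrite /= in_itv/= !mxE.
  rewrite lebesgue_rV_box ?ltry// => i.
  by rewrite !mxE (le_trans _ (normr_ge0 K))// oppr_le0.
Qed.

Lemma Lnorm_cst_restrict n p (D : set 'rV[R]_n) (M : R) : (1 <= p)%E ->
  measurable D -> (lebesgue_rV R n D < +oo)%E -> 0 <= M ->
  ('N[lebesgue_rV R n]_p[EFin \o (cst M \_ D)] <= (M * volume_root p D)%:E)%E.
Proof.
move=> p1 mD Doo M0; case: p p1 => [r r1|_|//] /=; last first.
  rewrite mulr1; apply: Lnormy_le; first by rewrite lee_fin.
  apply: nearW => x /=; rewrite lee_fin patchE.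
  by case: ifP => _; rewrite ?normr0 ?ger0_norm.
have r0 : 0 < r by rewrite (lt_le_trans ltr01).
have fD : lebesgue_rV R n D \is a fin_num by rewrite ge0_fin_numE.
rewrite unlock; under eq_integral => x _.
  rewrite /= (_ : _ `^ r = ((fun=> M `^ r) \_ D) x); last first.
    rewrite !patchE.
    by case: ifP => _; rewrite ?normr0 ?powR0 ?ger0_norm ?gt_eqF.
  over.
rewrite /= (_ : (fun x => _) = (cst (M `^ r)%:E) \_ D); last first.
  by apply/funext => x; rewrite !patchE; case: ifP.
rewrite -integral_mkcond integral_cst//.
rewrite poweRM ?lee_fin ?powR_ge0// poweR_EFin -powRrM.
by rewrite mulfV ?gt_eqF// powRr1// EFinM -poweR_EFin fineK.
Qed.

End EuclideanSpace.

(** * Order and truncation in the normed space L^p *)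

Section Lspace_order.
Context d (T : measurableType d) (R : realType).
Variables (mu : {measure set T -> \bar R}) (p : \bar R) (p1 : (1 <= p)%E).
Local Notation Lp := (LspaceType mu p1).
Implicit Types (u v : Lp) (rho : R).

Lemma le_Lspace_norm u v :
  (\forall x \ae mu, `|(u : T -> R) x| <= `|(v : T -> R) x|) -> `|u| <= `|v|.
Proof.
move=> uv; rewrite -lee_fin !Lspace_normE; apply: le_Lnorm => //.
- by apply/measurable_EFinP; exact: Lspace_measurable.
- by apply/measurable_EFinP; exact: Lspace_measurable.
Qed.

(** The form in which the linear growth of [f] and of [g] is used: [v] is the
    argument of the nonlinearity and [e] its constant term cut off to a set of
    finite measure. *)
Lemma Lnorm_le_affine (v e w : T -> R) (a : R) : 0 <= a ->
  measurable_fun setT w -> measurable_fun setT e -> v \in Lfun mu p ->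
  (forall x, `|w x| <= a * `|v x| + e x) ->
  ('N[mu]_p[EFin \o w] <= a%:E * 'N[mu]_p[EFin \o v] + 'N[mu]_p[EFin \o e])%E.
Proof.
move=> a0 mw me /[dup] vL; rewrite inE => /andP[/[!inE] mv _] wve.
have mav : measurable_fun setT (fun x => a * `|v x|).
  by apply: measurable_funM => //; exact: measurableT_comp.
pose V := Lfun_Sub p1 vL.
have -> : (a%:E * 'N[mu]_p[EFin \o v] = 'N[mu]_p[EFin \o (a \*: V)])%E.
  by rewrite LnormZ ger0_norm.
pose V' x := a * `|v x|.
have wV : ('N[mu]_p[EFin \o w] <= 'N[mu]_p[EFin \o V'] + 'N[mu]_p[EFin \o e])%E.
  apply: le_trans (eminkowski mu mav me p1).
  apply: le_Lnorm => //; [exact/measurable_EFinP| |].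
    exact/measurable_EFinP/measurable_funD.
  apply: nearW => x /=; rewrite lee_fin.
  exact: le_trans (wve x) (ler_norm _).
apply: (le_trans wV); rewrite leeD2r//.
apply: le_Lnorm => //; first exact/measurable_EFinP.
  exact/measurable_EFinP/measurable_funM.
by apply: nearW => x /=; rewrite lee_fin !normrM normr_id.
Qed.

Lemma excess_Lfun rho u : 0 <= rho ->
  (fun x => Num.max (`|(u : T -> R) x| - rho) 0) \in Lfun mu p.
Proof.
move=> rho0; have mu' := Lspace_measurable u.
have me : measurable_fun setT (fun x => Num.max (`|(u : T -> R) x| - rho) 0).
  apply: measurable_maxr => //; apply: measurable_funB => //.
  exact: measurableT_comp.
rewrite inE; apply/andP; split; rewrite inE//=.
apply: le_lt_trans (_ : 'N[mu]_p[EFin \o u] < _)%E; last first.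
  by rewrite -Lspace_normE ltry.
apply: le_Lnorm => //; try exact/measurable_EFinP.
apply: nearW => x /=; rewrite lee_fin ger0_norm ?le_max ?lexx ?orbT//.
by rewrite ge_max normr_ge0 lerBlDr lerDl rho0.
Qed.

(** The part of [|u|] above the level [rho], whose norm is the [L^p] distance
    from [u] to the [L^oo] ball of radius [rho]. *)
Definition excess rho (rho0 : 0 <= rho) u : Lp :=
  cls (Lfun_Sub p1 (excess_Lfun u rho0)).

Variables (rho : R) (rho0 : 0 <= rho).
Local Notation ex := (excess rho0).

Let exE u : (ex u : T -> R) =
  (fun x => Num.max (`|(u : T -> R) x| - rho) 0) %[ae mu].
Proof. exact: cls_ae. Qed.

Lemma Lspace0_ae : ((0 : Lp) : T -> R) = (fun=> 0) %[ae mu].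
Proof.
have -> : (0 : Lp) = cls (0 : LfunType mu p1) by [].
by apply: filterS (cls_ae (0 : LfunType mu p1)) => x /(_ I) ->.
Qed.

Lemma excess_eq0 u :
  ex u = 0 <-> (\forall x \ae mu, `|(u : T -> R) x| <= rho).
Proof.
have z0 := Lspace0_ae.
split=> [u0|urho].
  have := exE u; rewrite u0 => eu.
  apply: filterS2 z0 eu => x /(_ I) -> /(_ I)/esym/eqP.
  by rewrite eq_maxr subr_le0.
apply/Lspace_eqP.
apply: filterS3 z0 (exE u) urho => x /(_ I) -> /(_ I) -> urho _.
by apply/max_idPr; rewrite subr_le0.
Qed.

Lemma excess_convex (l : R) u v : 0 <= l <= 1 ->
  `|ex (l *: u + (1 - l) *: v)| <= l * `|ex u| + (1 - l) * `|ex v|.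
Proof.
move=> /andP[l0 l1]; have l10 : 0 <= 1 - l by rewrite subr_ge0.
apply: (@le_trans _ _ `|l *: ex u + (1 - l) *: ex v|); last first.
  by rewrite (le_trans (ler_normD _ _))// !normrZ !ger0_norm.
apply: le_Lspace_norm.
have e1 := exE (l *: u + (1 - l) *: v).
have e2 : \forall x \ae mu,
    ((l *: u + (1 - l) *: v : Lp) : T -> R) x =
    l * (u : T -> R) x + (1 - l) * (v : T -> R) x.
  move: (LspaceD_ae (l *: u) ((1 - l) *: v)) (LspaceZ_ae l u)
    (LspaceZ_ae (1 - l) v).
  by apply: filterS3 => x /(_ I) -> /(_ I) -> /(_ I) ->.
have e3 : \forall x \ae mu,
    ((l *: ex u + (1 - l) *: ex v : Lp) : T -> R) x =
    l * (ex u : T -> R) x + (1 - l) * (ex v : T -> R) x.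
  move: (LspaceD_ae (l *: ex u) ((1 - l) *: ex v)) (LspaceZ_ae l (ex u))
    (LspaceZ_ae (1 - l) (ex v)).
  by apply: filterS3 => x /(_ I) -> /(_ I) -> /(_ I) ->.
have {}e3 : \forall x \ae mu,
    ((l *: ex u + (1 - l) *: ex v : Lp) : T -> R) x =
    l * Num.max (`|(u : T -> R) x| - rho) 0 +
    (1 - l) * Num.max (`|(v : T -> R) x| - rho) 0.
  by apply: filterS3 e3 (exE u) (exE v) => x -> /(_ I) -> /(_ I) ->.
apply: filterS3 e1 e2 e3 => x /(_ I) -> -> ->.
set a := (u : T -> R) x; set b := (v : T -> R) x.
have mx0 (t : R) : 0 <= Num.max t 0 by rewrite le_max lexx orbT.
have mx (t : R) : t <= Num.max t 0 by rewrite le_max lexx.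
rewrite [leLHS]ger0_norm// [leRHS]ger0_norm ?addr_ge0 ?mulr_ge0//.
rewrite ge_max addr_ge0 ?mulr_ge0// andbT.
have := ler_normD (l * a) ((1 - l) * b).
rewrite !normrM (ger0_norm l0) (ger0_norm l10).
have := ler_wpM2l l0 (mx (`|a| - rho)); have := ler_wpM2l l10 (mx (`|b| - rho)).
lra.
Qed.

Lemma excess_add u r : `|ex (u + r)| <= `|ex u| + `|r|.
Proof.
(* The class of [|r|] is the excess of [r] above the level [0]. *)
pose s : Lp := cls (Lfun_Sub p1 (excess_Lfun r (lexx 0))).
have sE : (s : T -> R) = (fun x => Num.max (`|(r : T -> R) x| - 0) 0) %[ae mu].
  exact: cls_ae.
have <- : `|s| = `|r|.
  apply/eqP; rewrite eq_le; apply/andP; split; apply: le_Lspace_norm.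
    by apply: filterS sE => x /(_ I) ->; rewrite subr0 max_l// normr_id.
  by apply: filterS sE => x /(_ I) ->; rewrite subr0 max_l// normr_id.
apply: le_trans (ler_normD _ _); apply: le_Lspace_norm.
have e1 : \forall x \ae mu, ((ex u + s : Lp) : T -> R) x =
    Num.max (`|(u : T -> R) x| - rho) 0 + `|(r : T -> R) x|.
  move: (LspaceD_ae (ex u) s) (exE u) sE.
  apply: filterS3 => x /(_ I) -> /(_ I) -> /(_ I) ->.
  by rewrite subr0 (max_l (normr_ge0 _)).
have e2 := LspaceD_ae u r; have e3 := exE (u + r).
apply: filterS3 e1 e2 e3 => x -> /(_ I) e2 /(_ I) ->; rewrite e2.
have mx0 (t : R) : 0 <= Num.max t 0 by rewrite le_max lexx orbT.
rewrite [leLHS]ger0_norm// [leRHS]ger0_norm ?addr_ge0//.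
rewrite ge_max addr_ge0// andbT.
have := ler_normD ((u : T -> R) x) ((r : T -> R) x).
have : `|(u : T -> R) x| - rho <= Num.max (`|(u : T -> R) x| - rho) 0.
  by rewrite le_max lexx.
lra.
Qed.

End Lspace_order.

(** * Bounds on the nonlinearity *)

Lemma locally_lipschitz_continuous (R : realType) (f : R -> R) :
  locally_lipschitz f -> continuous f.
Proof.
move=> fL x; have [U Ux [M [_ /(_ _ (ltr_pwDr ltr01 (lexx M)))]]] := fL x.
set K := M + 1 => fK; apply/cvgrPdist_le => e e0.
have K0 : 0 < `|K| + 1 by rewrite ltr_wpDl.
near=> y.
have Uy : U y by near: y.
have Ux' : U x by exact: nbhs_singleton.
apply: (@le_trans _ _ ((`|K| + 1) * `|x - y|)).
  apply: (le_trans (fK (x, y) (conj Ux' Uy))) => /=.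
  by rewrite ler_wpM2r// (le_trans (ler_norm K))// lerDl.
rewrite mulrC -ler_pdivlMr//; near: y.
by apply: cvgr_dist_le => //; rewrite divr_gt0.
Unshelve. all: by end_near. Qed.

Section KernelNorm.
Context (R : realType) (N : nat).
Variables (Omega : set 'rV[R]_N) (J : 'rV[R]_N -> 'rV[R]_N -> R).
Local Notation mu := (lebesgue_rV R N).

Lemma kernel_norm_ge0 q : Omega !=set0 -> (0 <= kernel_norm Omega J q)%E.
Proof.
move=> [x Ox]; apply: le_trans (ereal_sup_ubound (ex_intro2 _ _ x Ox erefl)).
exact: Lnorm_ge0.
Qed.

(** A continuous kernel is bounded on a compact set containing
    [Omega * Omega], and [Omega] has finite measure. *)
Lemma kernel_norm_lty q : (1 <= q)%E -> open Omega -> bounded_set Omega ->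
  continuous (fun z : 'rV[R]_N * 'rV[R]_N => J z.1 z.2) ->
  (kernel_norm Omega J q < +oo)%E.
Proof.
move=> q1 oO bO cJ.
have mO : measurable Omega by exact: open_measurable_rV.
have [Q [OQ cQ mQ Qoo]] := bounded_sub_compact bO.
have Ooo : (mu Omega < +oo)%E.
  by apply: le_lt_trans Qoo; apply: le_measure => //; rewrite inE.
have [M [_ /(_ _ (ltr_pwDr ltr01 (lexx M)))]] : bounded_set
    ((fun z : 'rV[R]_N * 'rV[R]_N => J z.1 z.2) @` (Q `*` Q)).
  apply/compact_bounded/continuous_compact; first exact: continuous_subspaceT.
  exact: compact_setX.
set K := M + 1 => QK.
have mJx x : measurable_fun setT (J x).
  by apply: kernel_section_measurable; exact: continuous_measurable_rV2.
apply: le_lt_trans (ltry (`|K| * volume_root q Omega)).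
apply: ge_ereal_sup => _ [x Ox <-].
apply: le_trans (Lnorm_cst_restrict q1 mO Ooo (normr_ge0 K)).
apply: le_Lnorm => //.
- apply/measurable_EFinP; apply/(measurable_restrictT _ mO).
  exact: measurable_funTS (mJx x).
- by apply/measurable_EFinP; apply/(measurable_restrictT _ mO).
apply: nearW => y /=; rewrite lee_fin !patchE.
case: ifPn; rewrite ?normr0// inE => Oy.
rewrite normr_id; apply: le_trans (ler_norm K); apply: QK.
by exists (x, y) => //; split; exact: OQ.
Qed.

End KernelNorm.

Lemma abse_fine_le (R : realType) (t : \bar R) : (`|fine t|%:E <= `|t|)%E.
Proof. by case: t => [r||] /=; rewrite ?normr0 ?leey. Qed.

Section Model.
Context (R : realType) (N : nat) (p : \bar R) (p1 : (1 <= p)%E).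
Variables (Omega : set 'rV[R]_N) (J : 'rV[R]_N -> 'rV[R]_N -> R).
Variables (f g : R -> R) (h beta : R) (k1 k2 c1 c2 : R).
Local Notation mu := (lebesgue_rV R N).
Local Notation Lp := (LspaceType mu p1).
Local Notation F := (@Fmap R N p p1 Omega J f g h beta).
Local Notation vol := (volume_root p Omega).
Hypothesis mO : measurable Omega.
Hypothesis One : Omega !=set0.
Hypothesis Ooo : (mu Omega < +oo)%E.
Hypothesis mJ : measurable_fun setT (fun z : 'rV[R]_N * 'rV[R]_N => J z.1 z.2).
Hypothesis J0 : forall x y, 0 <= J x y.
Hypothesis J1r : forall x, (\int[mu]_y (J x y)%:E <= 1)%E.
Hypothesis J1l : forall y, (\int[mu]_x (J x y)%:E <= 1)%E.
Hypothesis Joo : (kernel_norm Omega J (hoelder_conjugate p) < +oo)%E.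
Hypothesis mf : measurable_fun setT f.
Hypothesis (h0 : 0 <= h) (beta0 : 0 <= beta).
Hypotheses (k1_ge0 : 0 <= k1) (k2_ge0 : 0 <= k2).
Hypotheses (c1_ge0 : 0 <= c1) (c2_ge0 : 0 <= c2).
Hypothesis g_growth : forall x, `|g x| <= k1 * `|x| + k2.
Hypothesis f_growth : forall x, `|f x| <= c1 * `|x| + c2.

Let mJx x : measurable_fun setT (J x).
Proof. exact: kernel_section_measurable. Qed.

(** Only the values of [f \o u] on [Omega] enter the integral operator; cutting
   off outside [Omega] puts them in [L^p] even when [f 0 != 0]. *)
Let source (u : Lp) : 'rV[R]_N -> R :=
  (fun y => `|f ((u : 'rV[R]_N -> R) y)|) \_ Omega.

Let source_ge0 u y : 0 <= source u y.
Proof. by rewrite /source patchE; case: ifP. Qed.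

Let mfu (u : Lp) : measurable_fun setT (f \o (u : 'rV[R]_N -> R)).
Proof. exact: (measurableT_comp mf (Lspace_measurable u)). Qed.

Let source_measurable u : measurable_fun setT (source u).
Proof.
apply/(measurable_restrictT _ mO); apply: measurable_funTS.
by apply: measurableT_comp => //; exact: mfu.
Qed.

Let source_norm u :
  ('N[mu]_p[EFin \o source u] <= (c1 * `|u| + c2 * vol)%:E)%E.
Proof.
have uc y : `|source u y| <=
    c1 * `|(u : 'rV[R]_N -> R) y| + (cst c2 \_ Omega) y.
  rewrite /source !patchE; case: ifPn => _; first by rewrite normr_id.
  by rewrite normr0 addr0 mulr_ge0.
have mc : measurable_fun setT (cst c2 \_ Omega).
  by apply/(measurable_restrictT _ mO).
have := Lnorm_le_affine p1 c1_ge0 (source_measurable u) mc (Lspace_Lfun u) uc.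
move=> /le_trans; apply.
rewrite EFinD EFinM Lspace_normE leeD2l//.
exact: Lnorm_cst_restrict.
Qed.

(** A nonnegative integral, possibly infinite, that dominates the operator with
   no integrability condition. *)
Let average u x := (\int[mu]_y (J x y * source u y)%:E)%E.

Let average_ge0 u x : (0 <= average u x)%E.
Proof. by apply: integral_ge0 => y _; rewrite lee_fin mulr_ge0. Qed.

Let Kop_le_average (u : Lp) x :
  (`|Kop Omega J (f \o (u : 'rV[R]_N -> R)) x|%:E <= average u x)%E.
Proof.
pose v y := J x y * f ((u : 'rV[R]_N -> R) y).
have mv : measurable_fun Omega (EFin \o v).
  apply/measurable_funTS/measurable_EFinP.
  exact: measurable_funM (mJx x) (mfu u).
apply: (le_trans (abse_fine_le _)).
apply: (le_trans (le_abse_integral _ mO mv)).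
rewrite integral_mkcond le_eqVlt; apply/orP; left; apply/eqP.
apply: eq_integral => y _; rewrite !patchE /source patchE.
by case: ifP => _; rewrite ?mulr0//= normrM ger0_norm.
Qed.

Let average_le (u : Lp) x : Omega x ->
  (average u x <= kernel_norm Omega J (hoelder_conjugate p) *
                  (c1 * `|u| + c2 * vol)%:E)%E.
Proof.
move=> Ox; pose Jx := J x \_ Omega.
have mJxO : measurable_fun setT Jx.
  by apply/(measurable_restrictT _ mO); exact: measurable_funTS (mJx x).
have JxK : ('N[mu]_(hoelder_conjugate p)[EFin \o Jx] <=
    kernel_norm Omega J (hoelder_conjugate p))%E.
  by apply: ereal_sup_ubound; exists x.
have -> : average u x = (\int[mu]_y `|(source u y * Jx y)%:E|)%E.
  apply: eq_integral => y _; rewrite /source /Jx !patchE.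
  case: ifP => _; last by rewrite !mulr0 abse0.
  by rewrite /= normrM normr_id (ger0_norm (J0 _ _)) mulrC.
apply: (le_trans (hoelder_conjugate_le mu p1 (source_measurable u) mJxO)).
by rewrite muleC lee_pmul// ?Lnorm_ge0//; exact: source_norm.
Qed.

Let average_fin (u : Lp) x : Omega x -> average u x \is a fin_num.
Proof.
move=> Ox; rewrite ge0_fin_numE// (le_lt_trans (average_le u Ox))//.
have K0 : (0 <= kernel_norm Omega J (hoelder_conjugate p))%E.
  by apply: kernel_norm_ge0; exists x.
by rewrite -(@fineK _ (kernel_norm _ _ _)) ?ge0_fin_numE// -EFinM ltry.
Qed.

Let vol_ge0 : 0 <= vol.
Proof. by rewrite /volume_root; case: (p) => [r||]//; rewrite powR_ge0. Qed.

Let Fval (u : Lp) : 'rV[R]_N -> R :=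
  (fun x => g (beta * Kop Omega J (f \o (u : 'rV[R]_N -> R)) x + beta * h))
  \_ Omega.

Let Fval_le u x : `|Fval u x| <=
  k1 * beta * `|fine (average u x)| + (cst (k1 * beta * h + k2) \_ Omega) x.
Proof.
rewrite /Fval !patchE; case: ifPn => [|_]; last first.
  by rewrite normr0 addr0 !mulr_ge0.
rewrite inE => Ox; apply: (le_trans (g_growth _)).
set K := Kop _ _ _ _.
have Ka : `|K| <= fine (average u x).
  by rewrite -lee_fin fineK ?average_fin//; exact: Kop_le_average.
rewrite (ger0_norm (fine_ge0 (average_ge0 u x))) addrA lerD2r.
rewrite -!mulrA -[leRHS]mulrDr ler_wpM2l// (le_trans (ler_normD _ _))//.
by rewrite !normrM (ger0_norm beta0) (ger0_norm h0) lerD2r ler_wpM2l.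
Qed.

(** Schur's test bounds the norm of the averages of [|f \o u|] by that of
    [f \o u] itself; this is why [J] leaves no trace in the constant in front of
    [|u|]. *)
Lemma Fmap_Lnorm_le (u : Lp) : `|F u| <=
  k1 * beta * c1 * `|u| + (k1 * beta * c2 + k1 * beta * h + k2) * vol.
Proof.
have b0 : 0 <= k1 * beta * h + k2 by rewrite addr_ge0 ?mulr_ge0.
(* A function outside [L^p] is sent to the class [0], and then the bound only
   says that the right-hand side is nonnegative. *)
rewrite /Fmap /Lp_class; case: pselect => [vL|_]; last first.
  rewrite normr0 addr_ge0 ?mulr_ge0//.
  by rewrite -addrA addr_ge0 ?mulr_ge0.
rewrite -lee_fin.
rewrite [X in (X <= _)%E](_ : _ = 'N[mu]_p[EFin \o Fval u])%E; last first.
  rewrite [X in X%:E]Lspace_norm_cls.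
  exact: (finite_norm_fine (Lfun_Sub p1 vL)).
have ma : measurable_fun setT (average u) by exact: kernel_average_measurable.
have aN : ('N[mu]_p[EFin \o (fine \o average u)] <=
    (c1 * `|u| + c2 * vol)%:E)%E.
  apply: (le_trans _ (source_norm u)).
  apply: (le_trans _ (schur_test mJ J0 J1r J1l p1 (source_measurable u)
    (source_ge0 u))).
  apply: le_Lnorm => //.
    by apply/measurable_EFinP; exact: measurableT_comp.
  by apply: nearW => x; exact: abse_fine_le.
have aL : (fine \o average u) \in Lfun mu p.
  rewrite inE; apply/andP; split; rewrite inE/=; first exact: measurableT_comp.
  exact: le_lt_trans aN (ltry _).
have mFv : measurable_fun setT (Fval u).
  by move: vL; rewrite inE => /andP[/[!inE]].
have kb0 : 0 <= k1 * beta by rewrite mulr_ge0.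
apply: (le_trans (Lnorm_le_affine p1 kb0 mFv _ aL (Fval_le u))).
  by apply/(measurable_restrictT _ mO).
apply: (@le_trans _ _ ((k1 * beta)%:E * (c1 * `|u| + c2 * vol)%:E +
  ((k1 * beta * h + k2) * vol)%:E)%E).
  rewrite leeD ?lee_wpmul2l ?lee_fin//.
  exact: Lnorm_cst_restrict.
rewrite -EFinM -EFinD lee_fin le_eqVlt; apply/orP; left; apply/eqP; ring.
Qed.

(** [F] maps [L^p] to [L^oo]: for each [x] the average of [|f \o u|] against
    [J x] is bounded by Hoelder's inequality. *)
Lemma Fmap_Linfty_le (u : Lp) :
  \forall x \ae mu, `|(F u : 'rV[R]_N -> R) x| <=
  k1 * beta * fine (kernel_norm Omega J (hoelder_conjugate p)) *
    (c1 * `|u| + c2 * vol) + (k1 * beta * h + k2).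
Proof.
pose j := kernel_norm Omega J (hoelder_conjugate p).
have j0 : (0 <= j)%E by exact: kernel_norm_ge0.
have b0 : 0 <= k1 * beta * h + k2 by rewrite addr_ge0 ?mulr_ge0.
have kb0 : 0 <= k1 * beta by rewrite mulr_ge0.
have n0 : 0 <= c1 * `|u| + c2 * vol by rewrite addr_ge0 ?mulr_ge0.
have jn0 : 0 <= k1 * beta * fine j * (c1 * `|u| + c2 * vol).
  by rewrite mulr_ge0// mulr_ge0// fine_ge0.
rewrite /Fmap /Lp_class; case: pselect => [vL|_]; last first.
  by apply: filterS (Lspace0_ae mu p1) => x /(_ I) ->; rewrite normr0 addr_ge0.
apply: filterS (cls_ae (Lfun_Sub p1 vL)) => x /(_ I) ->.
have [Ox|Ox] := boolP (x \in Omega); last first.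
  by rewrite /= patchE (negbTE Ox) normr0 addr_ge0.
apply: (le_trans (Fval_le u x)).
rewrite patchE Ox lerD2r -[leRHS]mulrA ler_wpM2l//.
rewrite inE in Ox; rewrite ger0_norm ?fine_ge0// -lee_fin fineK ?average_fin//.
by rewrite EFinM fineK ?ge0_fin_numE//; exact: average_le.
Qed.

End Model.

(** * The attractor *)

Theorem theorem5p4 (R : realType) (N : nat) (hN : (0 < N)%N)
    (Omega : set 'rV[R]_N) (hOmega : bounded_smooth_domain Omega)
    (J : 'rV[R]_N -> 'rV[R]_N -> R) (hJ : interaction_kernel J)
    (h beta : R) (h0 : 0 <= h) (beta0 : 0 <= beta)
    (p : \bar R) (p1 : (1 <= p)%E)
    (f g : R -> R) (hf : locally_lipschitz f) (hg : locally_lipschitz g)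
    (k1 k2 c1 c2 : R) (k1_ge0 : 0 <= k1) (k2_ge0 : 0 <= k2)
    (c1_ge0 : 0 <= c1) (c2_ge0 : 0 <= c2)
    (g_growth : forall x, `|g x| <= k1 * `|x| + k2)
    (f_growth : forall x, `|f x| <= c1 * `|x| + c2)
    (dissip : k1 * beta * c1 < 1)
    (g_C1 : Ck 1 g)
    (k3 k4 : R) (k3_ge0 : 0 <= k3) (k4_ge0 : 0 <= k4)
    (dg_growth : forall x, `|derive1 g x| <= k3 * `|x| + k4)
    (T : R -> LspaceType (lebesgue_rV R N) p1 -> LspaceType (lebesgue_rV R N) p1)
    (hT : flow Omega J f g h beta T)
    (A : set (LspaceType (lebesgue_rV R N) p1))
    (hA : global_attractor (phase_space Omega) T A)
    (sigma : R) (sigma0 : 0 < sigma) :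
  let Rad := (1 + sigma) *
    (((k1 * beta * c2 + k1 * beta * h + k2) * volume_root p Omega) /
     (1 - k1 * beta * c1)) in
  let Jq := kernel_norm Omega J (hoelder_conjugate p) in
  let rho := ((k1 * beta)%:E * Jq * (c1 * Rad)%:E +
              (k1 * beta)%:E * Jq * (c2 * volume_root p Omega)%:E +
              (k1 * beta * h + k2)%:E)%E in
  A `<=` Linfty_ball Omega rho.
Proof.
move=> Rad Jq rho u Au.
have [One oO _ bO _] := hOmega; have [J0 _ [cJ _] J1r J1l] := hJ.
have [AX cA iA _ _] := hA.
have mO : measurable Omega by exact: open_measurable_rV.
have Ooo : (lebesgue_rV R N Omega < +oo)%E.
  have [Q [OQ _ mQ Qoo]] := bounded_sub_compact bO.
  by apply: le_lt_trans Qoo; apply: le_measure => //; rewrite inE.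
have mJ : measurable_fun setT (fun z : 'rV[R]_N * 'rV[R]_N => J z.1 z.2).
  exact: continuous_measurable_rV2.
have J1r' x : (\int[lebesgue_rV R N]_y (J x y)%:E <= 1)%E by rewrite J1r.
have J1l' y : (\int[lebesgue_rV R N]_x (J x y)%:E <= 1)%E by rewrite J1l.
have Joo : (Jq < +oo)%E.
  by apply: kernel_norm_lty => //; exact: hoelder_conj_ge1.
have Jq0 : (0 <= Jq)%E by exact: kernel_norm_ge0.
have mf : measurable_fun setT f.
  by apply: continuous_measurable_fun; exact: locally_lipschitz_continuous.
pose F := Fmap Omega J f g h beta : LspaceType (lebesgue_rV R N) p1 -> _.
have dT w : A w -> is_derive (1 : R) (1 : R) (fun t => T t w)
    (- T 1 w + F (T 1 w)).
  by move=> /AX /hT [_ _ _ dw]; exact: dw ltr01.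
pose b := (k1 * beta * c2 + k1 * beta * h + k2) * volume_root p Omega.
have vol_ge0 : 0 <= volume_root p Omega.
  by rewrite /volume_root; case: (p) => [r||]//; rewrite powR_ge0.
have normA v : A v -> `|v| <= Rad.
  move=> Av; apply: (@le_trans _ _ (b / (1 - k1 * beta * c1))).
    apply: (invariant_set_bound (Phi := fun w => `|w|) _ _ cA iA dT) => //.
    - move=> l x y /andP[l0 l1]; rewrite (le_trans (ler_normD _ _))// !normrZ.
      by rewrite (ger0_norm l0) ger0_norm// subr_ge0.
    - by move=> x y; exact: ler_normD.
    - by move=> w Aw; exact: Fmap_Lnorm_le.
  rewrite /Rad ler_peMl ?lerDl ?(ltW sigma0)//.
  by rewrite divr_ge0 ?subr_ge0 ?(ltW dissip)// mulr_ge0 ?addr_ge0 ?mulr_ge0.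
pose j := fine Jq; have j0 : 0 <= j by exact: fine_ge0.
pose r := k1 * beta * j * (c1 * Rad + c2 * volume_root p Omega) +
          (k1 * beta * h + k2).
have rhoE : rho = r%:E.
  rewrite /rho -[Jq]fineK ?ge0_fin_numE// -!EFinM -!EFinD; congr EFin.
  by rewrite /r mulrDr addrA.
have Rad0 : 0 <= Rad by exact: le_trans (normA _ Au).
have s0 : 0 <= c1 * Rad + c2 * volume_root p Omega.
  by apply: addr_ge0; exact: mulr_ge0.
have b0 : 0 <= k1 * beta * h + k2 by rewrite addr_ge0 ?mulr_ge0.
have r0 : 0 <= r by rewrite /r addr_ge0// mulr_ge0// !mulr_ge0.
have FA w : A w -> `|excess r0 (F w)| <= 0 * `|excess r0 w| + 0.
  move=> Aw; rewrite mul0r addr0 normr_le0; apply/eqP/excess_eq0.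
  have Fw := Fmap_Linfty_le mO One Ooo mJ J0 Joo mf h0 beta0 k1_ge0 k2_ge0
    c1_ge0 c2_ge0 g_growth f_growth w.
  apply: filterS Fw => x /le_trans; apply.
  rewrite lerD2r ler_wpM2l ?mulr_ge0// lerD2r ler_wpM2l//.
  exact: normA.
have : `|excess r0 u| <= 0 / (1 - 0).
  apply: (invariant_set_bound (Phi := fun w => `|excess r0 w|) _ _ cA iA dT)
    => //.
  - by move=> l x y; exact: excess_convex.
  - by move=> x y; exact: excess_add.
rewrite mul0r normr_le0 => /eqP/excess_eq0 ur.
have ub : ('N[lebesgue_rV R N]_+oo[EFin \o u] <= rho)%E.
  by rewrite rhoE; apply: Lnormy_le; [rewrite lee_fin|exact: filterS ur].
split => //; first exact: AX.
rewrite inE; apply/andP; split; rewrite inE/=; first exact: Lspace_measurable.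
by rewrite /finite_norm (le_lt_trans ub)// rhoE ltry.
Qed.
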